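(* A graph $G$ is complementary vanishing if and only if $G\in \mathcal{R}\setminus \mathcal{C}$.
   Context: All graphs are finite and simple. For a graph $G$ with vertex set $\{v_1,\dots,v_n\}$, $\mathcal{S}(G)$ is the set of real symmetric $n\times n$ matrices $A=[a_{i,j}]$ such that for $i\neq j$, $a_{i,j}\neq 0$ if and only if $v_iv_j\in E(G)$ (diagonal entries are unrestricted). $\overline{G}$ denotes the complement of $G$. A graph $G$ is complementary vanishing if there exist $A\in\mathcal{S}(G)$ and $B\in\mathcal{S}(\overline{G})$ with $AB=O$. $G\sqcup H$ is the disjoint union and $G\vee H$ the join (disjoint union plus all edges between $G$ and $H$). $\mathcal{M}$ is the set of complementary vanishing graphs $G$ such that both $G$ and $\overline{G}$ are connected. $\mathcal{R}$ is the smallest set of graphs containing $\mathcal{M}$ that is closed under disjoint unions, joins, and complements. $\mathcal{C}$ is the set of graphs $G$ such that in $G$ or in $\overline{G}$ (with neighborhoods taken in that graph) there exist distinct vertices $u,v,w$ with $v,w\notin N(u)$, $|N(u)\setminus N(w)|=1$, and $|N(u)\setminus N(v)|=0$, where $N(x)$ is the open neighborhood of $x$. *)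

(* Defs.v *)
From mathcomp Require Import all_boot all_order all_algebra.
From mathcomp Require Import reals.

Set Implicit Arguments.
Unset Strict Implicit.
Unset Printing Implicit Defensive.

Import GRing.Theory.
Local Open Scope ring_scope.

(* Finite simple graphs; the graph with no vertices is allowed. *)
Record sgraph := SGraph {
  vertex :> finType;
  edge : rel vertex;
  edge_sym : symmetric edge;
  edge_irr : irreflexive edge }.

Arguments edge {s}.

Section Complement.
Variable G : sgraph.

Definition compl_edge : rel G := [rel x y | (x != y) && ~~ edge x y].

Fact compl_edge_sym : symmetric compl_edge.
Proof. by move=> x y; rewrite /compl_edge /= eq_sym edge_sym. Qed.

Fact compl_edge_irr : irreflexive compl_edge.
Proof. by move=> x; rewrite /compl_edge /= eqxx. Qed.

Definition compl : sgraph := SGraph compl_edge_sym compl_edge_irr.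

End Complement.

Section UnionJoin.
Variables G H : sgraph.

Definition union_edge : rel (G + H)%type := fun x y =>
  match x, y with
  | inl a, inl b => edge a b
  | inr a, inr b => edge a b
  | _, _ => false
  end.

Fact union_edge_sym : symmetric union_edge.
Proof. by move=> [x|x] [y|y] //=; apply: edge_sym. Qed.

Fact union_edge_irr : irreflexive union_edge.
Proof. by move=> [x|x] /=; apply: edge_irr. Qed.

Definition disjoint_union : sgraph := SGraph union_edge_sym union_edge_irr.

Definition join_edge : rel (G + H)%type := fun x y =>
  match x, y with
  | inl a, inl b => edge a b
  | inr a, inr b => edge a b
  | _, _ => true
  end.

Fact join_edge_sym : symmetric join_edge.
Proof. by move=> [x|x] [y|y] //=; apply: edge_sym. Qed.

Fact join_edge_irr : irreflexive join_edge.
Proof. by move=> [x|x] /=; apply: edge_irr. Qed.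

Definition join : sgraph := SGraph join_edge_sym join_edge_irr.

End UnionJoin.

Definition graph_iso (G H : sgraph) : Prop :=
  exists2 f : G -> H, bijective f & {mono f : x y / edge x y}.

(* Under this convention the graph with no vertices is connected. *)
Definition connected (G : sgraph) : Prop := forall x y : G, connect edge x y.

(* S(G): vertices are numbered by [enum_val : 'I_#|G| -> G]. *)
Definition symm_mx_of (R : realType) (G : sgraph) (A : 'M[R]_#|G|) : Prop :=
  A^T = A /\
  forall i j : 'I_#|G|, i != j ->
    (A i j != 0 <-> edge (enum_val i) (enum_val j)).

(* [compl G] has the same vertex type as G, hence the same numbering. *)
Definition complementary_vanishing (R : realType) (G : sgraph) : Prop :=
  exists (A : 'M[R]_#|G|) (B : 'M[R]_#|compl G|),
    [/\ @symm_mx_of R G A, @symm_mx_of R (compl G) B & A *m B = 0].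

Definition classM (R : realType) (G : sgraph) : Prop :=
  [/\ complementary_vanishing R G, connected G & connected (compl G)].

(* Graphs are taken up to isomorphism: without [classR_iso], only graphs whose
   vertex type is literally a sum type could arise as unions and joins. *)
Inductive classR (R : realType) : sgraph -> Prop :=
  | classR_M G : classM R G -> classR R G
  | classR_union G H : classR R G -> classR R H -> classR R (disjoint_union G H)
  | classR_join G H : classR R G -> classR R H -> classR R (join G H)
  | classR_compl G : classR R G -> classR R (compl G)
  | classR_iso G H : graph_iso G H -> classR R G -> classR R H.

Definition nbh (G : sgraph) (x : G) : {set G} := [set y | edge x y].

Definition forbidden_triple (G : sgraph) : Prop :=
  exists u v w : G,
    uniq [:: u; v; w] /\
    [/\ v \notin nbh u, w \notin nbh u,
        #|nbh u :\: nbh w| = 1%N & #|nbh u :\: nbh v| = 0%N].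

Definition classC (G : sgraph) : Prop :=
  forbidden_triple G \/ forbidden_triple (compl G).

(* Main.v *)
(* If AB = 0 and G splits into components, the diagonal blocks of A and B show
   that each component is complementary vanishing.  Conversely, gluing pairs
   (A1, B1) and (A2, B2) along a disjoint union amounts to filling the
   off-diagonal block of B with x1 x2^T, where x1 and x2 are nowhere zero kernel
   vectors of A1 and A2.  Outside of C no component with at least three vertices
   has a leaf, and then such kernel vectors exist, possibly after changing the
   row and column of A at a dominating vertex.  Joins reduce to disjoint unions
   by taking complements, which exchanges A and B. *)
Require Import Defs.
From mathcomp Require Import all_boot all_order all_algebra.
From mathcomp Require Import reals.

Set Implicit Arguments.
Unset Strict Implicit.
Unset Printing Implicit Defensive.

Import GRing.Theory Num.Theory.
Local Open Scope ring_scope.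

(** * Vectors avoiding the zeros of finitely many linear forms *)

Lemma exists_nonroot (F : numDomainType) (p : {poly F}) :
  p != 0 -> exists t, p.[t] != 0.
Proof.
(* A nonzero [p] has fewer than [size p] roots, so the distinct points 0, 1, ..., [size p - 1]
   cannot all be roots. *)
move=> p_neq0; pose s : seq F := [seq i%:R | i <- iota 0 (size p)].
have [|/allPn[t _ pt]] := boolP (all (root p) s); last by exists t.
move=> /(max_poly_roots p_neq0); rewrite size_map size_iota ltnn => max_s.
suff /max_s : uniq s by [].
by rewrite map_inj_uniq ?iota_uniq // => i j /eqP; rewrite eqr_nat => /eqP.
Qed.

(* A point of the moment curve works: on it each form becomes a nonzero
   polynomial in the parameter. *)
Lemma exists_generic_vector (F : numDomainType) (T K : finType)
    (l : K -> T -> F) :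
  (forall k, exists j, l k j != 0) ->
  exists c : T -> F, forall k, \sum_j l k j * c j != 0.
Proof.
move=> l_neq0.
pose p k : {poly F} := \sum_j (l k j)%:P * 'X^(enum_rank j).
have pE k j : (p k)`_(enum_rank j) = l k j.
  rewrite coef_sum (bigD1 j) //= coefCM coefXn eqxx mulr1 big1 ?addr0 // => i ij.
  rewrite coefCM coefXn (inj_eq val_inj) (inj_eq enum_rank_inj).
  by rewrite eq_sym (negPf ij) mulr0.
have p_neq0 k : p k != 0.
  have [j] := l_neq0 k; apply: contraNneq => pk0.
  by rewrite -pE pk0 coef0.
(* One nonroot of the product serves all the forms at once. *)
have /exists_nonroot[t] : \prod_k p k != 0 by apply/prodf_neq0 => k _.
rewrite horner_prod => /prodf_neq0 pt_neq0.
exists (fun j => t ^+ enum_rank j) => k.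
have := pt_neq0 k isT; rewrite horner_sum; congr (_ != 0).
by apply: eq_bigr => j _; rewrite hornerM hornerC hornerXn.
Qed.

(** * Symmetric pairs with product zero, complements and isomorphisms *)

(** Entries are indexed by vertices, so that restriction to a subgraph and gluing along a sum type
    avoid the numbering by ordinals. *)
Definition vanishing_pair (F : nzRingType) (G : sgraph) (a b : G -> G -> F) :=
  [/\ forall x y, a x y = a y x,
      forall x y, b x y = b y x,
      forall x y, x != y -> (a x y != 0) = edge x y,
      forall x y, x != y -> (b x y != 0) = ~~ edge x y
    & forall x z, \sum_y a x y * b y z = 0].

Lemma compl_edgeE (G : sgraph) (x y : G) :
  @edge (compl G) x y = (x != y) && ~~ edge x y.
Proof. by []. Qed.

Lemma complementary_vanishingP (R : realType) (G : sgraph) :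
  complementary_vanishing R G <-> exists a b : G -> G -> R, vanishing_pair a b.
Proof.
split=> [[A [B [[At Ae] [Bt Be] AB]]]|[a [b [as_ bs ae be ab]]]].
  exists (fun x y => A (enum_rank x) (enum_rank y)).
  exists (fun x y => B (enum_rank x) (enum_rank y)).
  split=> [x y|x y|x y xy|x y xy|x z].
  - by rewrite -{1}At mxE.
  - by rewrite -{1}Bt mxE.
  - have := Ae (enum_rank x) (enum_rank y).
    rewrite (inj_eq enum_rank_inj) !enum_rankK => /(_ xy) [h1 h2].
    by apply/idP/idP.
  - have := Be (enum_rank x) (enum_rank y).
    rewrite (inj_eq enum_rank_inj) !enum_rankK => /(_ xy) [h1 h2].
    rewrite compl_edgeE xy /= in h1 h2.
    by apply/idP/idP.
  - have /matrixP/(_ (enum_rank x) (enum_rank z)) := AB.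
    rewrite !mxE (reindex enum_rank) //=.
    by apply: onW_bij; apply: enum_rank_bij.
exists (\matrix_(i, j) a (enum_val i) (enum_val j)).
exists (\matrix_(i, j) b (enum_val i) (enum_val j)).
split.
- split=> [|i j ij]; first by apply/matrixP => i j; rewrite !mxE.
  by rewrite mxE ae // (inj_eq enum_val_inj).
- split=> [|i j ij]; first by apply/matrixP => i j; rewrite !mxE.
  by rewrite mxE be ?(inj_eq enum_val_inj) // compl_edgeE (inj_eq enum_val_inj) ij.
- apply/matrixP => i k; rewrite !mxE.
  rewrite -[RHS](ab (enum_val i) (enum_val k)) [RHS](reindex (enum_val : 'I_#|G| -> G)) /=.
    by apply: eq_bigr => j _; rewrite !mxE.
  by apply: onW_bij; apply: enum_val_bij.
Qed.

Lemma complementary_vanishing_compl (R : realType) (G : sgraph) :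
  complementary_vanishing R G -> complementary_vanishing R (compl G).
Proof.
move=> /complementary_vanishingP[a [b [as_ bs ae be ab]]].
apply/complementary_vanishingP; exists b, a; split=> // [x y xy|x y xy|x z].
- by rewrite compl_edgeE xy be.
- by rewrite compl_edgeE xy ae // negbK.
(* By symmetry, transposing $AB = 0$ gives $BA = 0$. *)
- rewrite -[RHS](ab z x); apply: eq_bigr => y _.
  by rewrite mulrC as_ bs.
Qed.

Lemma graph_iso_sym (G H : sgraph) : graph_iso G H -> graph_iso H G.
Proof.
move=> [f [g fK gK] fe]; exists g; first by exists f.
by move=> x y; rewrite -fe !gK.
Qed.

Lemma complementary_vanishing_iso (R : realType) (G H : sgraph) :
  graph_iso G H -> complementary_vanishing R G -> complementary_vanishing R H.
Proof.
move=> /graph_iso_sym[f fbij fe] /complementary_vanishingP[a [b [as_ bs ae be ab]]].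
have finj := bij_inj fbij.
apply/complementary_vanishingP.
exists (fun x y => a (f x) (f y)), (fun x y => b (f x) (f y)).
split=> // [x y xy|x y xy|x z].
- by rewrite -fe ae // inj_eq.
- by rewrite -fe be // inj_eq.
- rewrite -[RHS](ab (f x) (f z)) [RHS](reindex f) //=.
  exact: onW_bij.
Qed.

Lemma complK (G : sgraph) : graph_iso (compl (compl G)) G.
Proof.
exists id => [|x y]; first by exists id.
by rewrite !compl_edgeE; case: eqVneq => //= [->|_]; rewrite ?edge_irr ?negbK.
Qed.

(** De Morgan's law, which turns the join step of the induction over [classR] into a union step. *)
Lemma compl_join (G H : sgraph) :
  graph_iso (compl (disjoint_union (compl G) (compl H))) (join G H).
Proof.
exists id => [|]; first by exists id.
have inlE x y : (inl x == inl y :> (G + H)%type) = (x == y) by [].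
have inrE x y : (inr x == inr y :> (G + H)%type) = (x == y) by [].
move=> [x|x] [y|y] //; rewrite compl_edgeE /= ?inlE ?inrE /compl_edge /=.
  by case: eqVneq => //= [->|_]; rewrite ?edge_irr ?negbK.
by case: eqVneq => //= [->|_]; rewrite ?edge_irr ?negbK.
Qed.

(** * Forbidden triples and their transfer along modules *)

(** The vertex [d] is the single element of $N(u) \setminus N(w)$. *)
Definition is_triple (G : sgraph) (u v w d : G) :=
  [/\ uniq [:: u; v; w], ~~ edge u v, ~~ edge u w,
      forall y, edge u y && ~~ edge w y = (y == d)
    & forall y, edge u y -> edge v y].

Lemma forbidden_tripleP (G : sgraph) :
  forbidden_triple G <-> exists u v w d : G, is_triple u v w d.
Proof.
split=> [[u [v [w [uvw [uv uw /eqP/cards1P[d dP] /eqP]]]]]|].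
  rewrite cards_eq0 setD_eq0 => /subsetP uNv.
  exists u, v, w, d; split=> //.
  - by move: uv; rewrite inE.
  - by move: uw; rewrite inE.
  - by move=> y; rewrite andbC; have /setP/(_ y) := dP; rewrite !inE.
  - by move=> y; have := uNv y; rewrite !inE.
move=> [u [v [w [d [uvw uv uw dP uNv]]]]]; exists u, v, w; split=> //.
split; rewrite ?inE //.
  apply/eqP/cards1P; exists d; apply/setP => y.
  by rewrite !inE andbC dP.
apply/eqP; rewrite cards_eq0 setD_eq0; apply/subsetP => y.
by rewrite !inE; apply: uNv.
Qed.

(** The image is a module in the sense of modular decomposition: a vertex outside sees all of it or
    none of it. *)
Definition module_embedding (H G : sgraph) (f : H -> G) :=
  [/\ injective f, {mono f : x y / edge x y}
    & forall y, (exists x, y = f x) \/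
        (y \notin codom f /\ forall u w, edge (f u) y = edge (f w) y)].

Lemma module_embedding_compl (H G : sgraph) (f : H -> G) :
  module_embedding f -> @module_embedding (compl H) (compl G) f.
Proof.
move=> [finj fe fm]; split=> // [x y|y].
  by rewrite !compl_edgeE fe inj_eq.
case: (fm y) => [|[yf yE]]; [by left | right; split=> // u w].
rewrite !compl_edgeE (yE u w).
by do 2![rewrite (_ : (_ != y) = true);
  last by apply: contraNneq yf => <-; apply: codom_f].
Qed.

(** A vertex outside of the image lies in all three neighborhoods or in none, so it never enters
    their differences. *)
Lemma forbidden_triple_embedding (H G : sgraph) (f : H -> G) :
  module_embedding f -> forbidden_triple H -> forbidden_triple G.
Proof.
move=> [finj fe fm] /forbidden_tripleP[u [v [w [d [uvw uv uw dP uNv]]]]].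
apply/forbidden_tripleP; exists (f u), (f v), (f w), (f d); split.
- by rewrite -[[:: _; _; _]]/(map f [:: u; v; w]) map_inj_uniq.
- by rewrite fe.
- by rewrite fe.
- move=> y; case: (fm y) => [[x ->]|[yf yE]].
    by rewrite !fe inj_eq.
  rewrite (yE u w) andbN; apply/esym/negbTE.
  by apply: contraNneq yf => ->; apply: codom_f.
- move=> y; case: (fm y) => [[x ->]|[_ yE]]; first by rewrite !fe; apply: uNv.
  by rewrite (yE u v).
Qed.

Lemma classC_embedding (H G : sgraph) (f : H -> G) :
  module_embedding f -> classC H -> classC G.
Proof.
move=> fm [|] HC; [left|right]; apply: forbidden_triple_embedding HC.
  exact: fm.
exact: module_embedding_compl fm.
Qed.

Lemma classC_iso (G H : sgraph) : graph_iso G H -> classC G -> classC H.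
Proof.
move=> [f fbij fe]; apply: (@classC_embedding _ _ f); split=> //.
  exact: bij_inj fbij.
by move=> y; left; have [g _ gK] := fbij; exists (g y); rewrite gK.
Qed.

Lemma classC_compl (G : sgraph) : classC (compl G) -> classC G.
Proof.
case=> [|GC]; [by right | left].
have [f fbij fe] := complK G.
apply: (@forbidden_triple_embedding _ _ f) GC; split=> //.
  exact: bij_inj fbij.
by move=> y; left; have [g _ gK] := fbij; exists (g y); rewrite gK.
Qed.

Lemma inl_embedding (G H : sgraph) :
  @module_embedding G (disjoint_union G H) inl.
Proof.
split=> [x y [] //|//|[x|y]]; first by left; exists x.
by right; split=> //; apply/codomP => -[].
Qed.

Lemma inr_embedding (G H : sgraph) :
  @module_embedding H (disjoint_union G H) inr.
Proof.
split=> [x y [] //|//|[y|x]]; last by left; exists x.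
by right; split=> //; apply/codomP => -[].
Qed.

(* The two entries (u, v) and (u, w) of the product force the diagonal entry
   at [u] to be zero and nonzero, respectively. *)
Lemma complementary_vanishing_no_triple (R : realType) (G : sgraph) :
  complementary_vanishing R G -> ~ forbidden_triple G.
Proof.
move=> /complementary_vanishingP[a [b [as_ bs ae be ab]]].
move=> /forbidden_tripleP[u [v [w [d [uvw uv uw dP uNv]]]]].
move: uvw; rewrite /= !inE negb_or => /and3P[/andP[u_v u_w] v_w _].
have b_neq0 x y : x != y -> ~~ edge x y -> b x y != 0 by move=> xy; rewrite be.
have a_eq0 x y : x != y -> ~~ edge x y -> a x y = 0.
  by move=> xy; rewrite -ae // negbK => /eqP.
have b_eq0 x y : edge x y -> b x y = 0.
  move=> xy; apply/eqP; rewrite -[_ == 0]negbK be ?xy //.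
  by apply: contraTneq xy => ->; rewrite edge_irr.
have auu : a u u = 0.
  (* Only the term at [u] survives: neighbors of [u] are neighbors of [v], where [b] vanishes, and
     at the other vertices [a] vanishes. *)
  have := ab u v; rewrite (bigD1 u) //= big1 => [/eqP|y yu].
    by rewrite addr0 mulf_eq0 (negPf (b_neq0 _ _ u_v uv)) orbF => /eqP.
  case: (boolP (edge u y)) => [/uNv vy|uy].
    by rewrite b_eq0 ?mulr0 // edge_sym.
  by rewrite a_eq0 ?mul0r // eq_sym.
have /andP[ud wd] : edge u d && ~~ edge w d by rewrite dP.
have u_d : u != d by apply: contraTneq ud => <-; rewrite edge_irr.
have w_d : w != d by apply: contraNneq uw => ->.
(* Since [a u u = 0], only [a u d * b d w] survives, and both factors are nonzero. *)
have := ab u w; rewrite (bigD1 d) //= big1 => [/eqP|y yd].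
  rewrite addr0 mulf_eq0 -[_ == 0]negbK ae // ud /= bs.
  by rewrite (negPf (b_neq0 _ _ w_d wd)).
have [->|yu] := eqVneq y u; first by rewrite auu mul0r.
have := dP y; rewrite (negPf yd); case: (boolP (edge u y)) => [uy /= /negbFE wy|uy _].
  by rewrite b_eq0 ?mulr0 // edge_sym.
by rewrite a_eq0 ?mul0r // eq_sym.
Qed.

Lemma complementary_vanishing_notC (R : realType) (G : sgraph) :
  complementary_vanishing R G -> ~ classC G.
Proof.
move=> GV [|].
  exact: complementary_vanishing_no_triple GV.
exact: complementary_vanishing_no_triple (complementary_vanishing_compl GV).
Qed.

(** * Splitting along components: vanishing graphs belong to [classR] *)

Section Induced.
Variables (G : sgraph) (P : pred G).

Definition induced_edge : rel {x | P x} := fun x y => edge (val x) (val y).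

Fact induced_edge_sym : symmetric induced_edge.
Proof. by move=> x y; apply: edge_sym. Qed.

Fact induced_edge_irr : irreflexive induced_edge.
Proof. by move=> x; apply: edge_irr. Qed.

Definition induced : sgraph := SGraph induced_edge_sym induced_edge_irr.

End Induced.

(** No edge leaves [P], so [a] is block diagonal and the mixed blocks of [b] do not enter the [P]
    block of the product. *)
Lemma complementary_vanishing_induced (R : realType) (G : sgraph) (P : pred G) :
  {in P & [predC P], forall x y, ~~ edge x y} ->
  complementary_vanishing R G -> complementary_vanishing R (induced P).
Proof.
move=> Pe /complementary_vanishingP[a [b [as_ bs ae be ab]]].
apply/complementary_vanishingP.
exists (fun x y => a (val x) (val y)), (fun x y => b (val x) (val y)).
split=> // [x y xy|x y xy|x z].
- by rewrite ae.
- by rewrite be.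
- rewrite -[RHS](ab (val x) (val z)) [RHS](bigID P) /= [X in _ + X]big1 ?addr0.
    by rewrite [RHS]big_sub.
  move=> y Py; rewrite (_ : a _ _ = 0) ?mul0r //; apply/eqP.
  have := Pe (val x) y (valP x) Py; rewrite -ae ?negbK //.
  by apply: contraNneq Py => <-; apply: valP.
Qed.

Lemma union_induced (G : sgraph) (P : pred G) :
  {in P & [predC P], forall x y, ~~ edge x y} ->
  graph_iso (disjoint_union (induced P) (induced (predC P))) G.
Proof.
move=> Pe.
pose f (s : {x | P x} + {x | predC P x}) : G :=
  match s with inl x => val x | inr x => val x end.
exists f.
  apply: inj_card_bij.
    move=> [x|x] [y|y] //= => [/val_inj->|xy|xy|/val_inj->] //.
      by have := valP y; rewrite /= -xy (valP x).
    by have := valP x; rewrite /= xy (valP y).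
  by rewrite card_sum !card_sig -(cardC P).
move=> [x|x] [y|y] //=; apply/negbTE; last rewrite edge_sym.
  exact: Pe (valP x) (valP y).
exact: Pe (valP y) (valP x).
Qed.

(** Strong induction on the order: if the graph or its complement is disconnected, the component of
    a vertex splits off; otherwise the graph lies in [classM]. *)
Lemma complementary_vanishing_classR (R : realType) (G : sgraph) :
  complementary_vanishing R G -> classR R G.
Proof.
have [n] := ubnP #|G|; elim: n G => // n IHn G; rewrite ltnS => leGn GV.
(* Stated for any [H] of the same order, to serve both [G] and [compl G]. *)
have split_case (H : sgraph) (x y : H) : #|H| = #|G| ->
    complementary_vanishing R H -> ~~ connect edge x y -> classR R H.
  move=> cardH HV xy; pose P : pred H := connect edge x.
  have Pe : {in P & [predC P], forall x y, ~~ edge x y}.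
    move=> s t xs; apply: contra => st.
    exact: connect_trans xs (connect1 st).
  have PCe : {in predC P & [predC predC P], forall x y, ~~ edge x y}.
    by move=> s t sP /negPn tP; rewrite edge_sym; apply: Pe.
  apply: classR_iso (union_induced Pe) _.
  have cardP : (#|P| + #|predC P| = #|G|)%N by rewrite cardC cardH.
  have P_gt0 : (0 < #|P|)%N by apply/card_gt0P; exists x; apply: connect0.
  have PC_gt0 : (0 < #|predC P|)%N by apply/card_gt0P; exists y.
  apply: classR_union; apply: IHn.
  - rewrite card_sig; apply: leq_trans leGn.
    by rewrite -cardP -addn1 leq_add2l.
  - exact: complementary_vanishing_induced.
  - rewrite card_sig; apply: leq_trans leGn.
    by rewrite -cardP -add1n leq_add2r.
  - exact: complementary_vanishing_induced.
have [/forallP conG|] := boolP [forall x : G, forall y : G, connect edge x y].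
  have [/forallP conC|] := boolP [forall x : compl G, forall y : compl G,
      connect edge x y].
    by apply: classR_M; split=> // x; apply/forallP.
  rewrite negb_forall => /existsP[x]; rewrite negb_forall => /existsP[y xy].
  apply: classR_iso (complK G) (classR_compl _).
  by apply: split_case xy => //; apply: complementary_vanishing_compl.
rewrite negb_forall => /existsP[x]; rewrite negb_forall => /existsP[y xy].
exact: split_case xy.
Qed.

(** * Nowhere zero kernel vectors *)

(** The pair is chosen together with [x], because a given [a] may have to be modified first. *)
Definition nonvanishing_kernel (F : nzRingType) (G : sgraph) :=
  exists (a b : G -> G -> F) (x : G -> F),
    [/\ vanishing_pair a b, forall i, x i != 0
      & forall i, \sum_j a i j * x j = 0].

(** A leaf is allowed only if its component is a single edge. *)
Definition no_pendant_leaf (G : sgraph) :=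
  forall u v d : G, (forall y, edge u y = (y == d)) -> v != u -> ~~ edge v d.

(** With $J$ the all ones matrix and $n$ the order, $J - nI$ kills the all ones vector; its partner
    may be zero, as the complement has no edges. *)
Lemma complete_nonvanishing_kernel (F : numDomainType) (G : sgraph) :
  (forall x y : G, x != y -> edge x y) -> nonvanishing_kernel F G.
Proof.
move=> Ge.
exists (fun x y => 1 - #|G|%:R * (x == y)%:R), (fun _ _ => 0), (fun=> 1).
split=> [|i|i]; last 2 first.
- exact: oner_neq0.
- under eq_bigr do rewrite mulr1.
  rewrite sumrB sumr_const (bigD1 i) //= eqxx mulr1 big1 ?addr0 ?subrr //.
  by move=> j; rewrite eq_sym => /negPf->; rewrite mulr0.
split=> // [x y|x y xy|x y xy|x z].
- by rewrite eq_sym.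
- by rewrite (negPf xy) mulr0 subr0 oner_neq0 Ge.
- by rewrite eqxx Ge.
- by apply: big1 => y _; rewrite mulr0.
Qed.

(* Without a dominating vertex no row of [b] vanishes, so a generic combination
   of the columns of [b] is a nowhere zero kernel vector of [a].  If [d] is
   dominating, row [d] of [b] is zero; then row and column [d] of [a] may be
   replaced by a generic vector in the column space of the rest of [a]. *)
Lemma vanishing_nonvanishing_kernel (R : realType) (G : sgraph) :
  no_pendant_leaf G -> complementary_vanishing R G -> nonvanishing_kernel R G.
Proof.
move=> leafG /complementary_vanishingP[a [b [as_ bs ae be ab]]].
have [/existsP[d /forallP dP]|] :=
    boolP [exists d : G, forall y, (y != d) ==> edge d y]; last first.
  rewrite negb_exists => /forallP nodom.
  have [k|c c_gen] := @exists_generic_vector R G G b.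
    have := nodom k; rewrite negb_forall => /existsP[j].
    by rewrite negb_imply => /andP[jk kj]; exists j; rewrite be // eq_sym.
  exists a, b, (fun i => \sum_j b i j * c j); split=> // i.
  under eq_bigr do rewrite mulr_sumr.
  rewrite exchange_big big1 //= => j _.
  under eq_bigr do rewrite mulrA.
  by rewrite -mulr_suml ab mul0r.
have {dP} dP y : y != d -> edge d y by move=> yd; have /implyP := dP y; apply.
have [/forallP cG|] := boolP [forall x : G, forall y, (x != y) ==> edge x y].
  by apply: complete_nonvanishing_kernel => x y; have /forallP/(_ y)/implyP := cG x.
rewrite negb_forall => /existsP[p]; rewrite negb_forall => /existsP[q].
rewrite negb_imply => /andP[pq pqe].
have bd y : b d y = 0.
  have bdy z : z != d -> b d z = 0.
    move=> zd; apply/eqP; rewrite -[_ == 0]negbK be ?dP //.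
    by rewrite eq_sym.
  (* The graph does not prescribe the diagonal entry; entry [(z, d)] of the product reduces to
     [a z d * b d d] with [a z d] nonzero. *)
  have [->|/bdy//] := eqVneq y d.
  have [z zd] : exists z, z != d.
    by have [pd|] := eqVneq p d; [exists q; rewrite -pd eq_sym | exists p].
  have := ab z d; rewrite (bigD1 d) //= big1 => [/eqP|i id]; last first.
    by rewrite bs bdy ?mulr0.
  by rewrite addr0 mulf_eq0 -[_ == 0]negbK ae // edge_sym dP //= => /eqP.
(* Otherwise [i] is a leaf at [d], so [i] and [d] are the only vertices and [p], [q] would be
   adjacent. *)
have nbr i : i != d -> exists2 j, j != d & edge i j.
  move=> id; have [/existsP[j /andP[]]|] :=
    boolP [exists j, (j != d) && edge i j]; first by exists j.
  rewrite negb_exists => /forallP nonbr.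
  have iE y : edge i y = (y == d).
    have [->|yd] := eqVneq y d; first by rewrite edge_sym dP.
    by have := nonbr y; rewrite yd /= => /negPf.
  have onlyi v : v != d -> v = i.
    move=> vd; apply/eqP; apply/negPn/negP => vi.
    by have := leafG i v d iE vi; rewrite edge_sym dP.
  case/negP: pqe; have [pd|/onlyi pi] := eqVneq p d.
    by rewrite pd dP // -pd eq_sym.
  rewrite pi iE; apply/eqP/esym/eqP; apply: contraNT pq => qd.
  by rewrite pi eq_sym; apply/eqP/onlyi; rewrite eq_sym.
(* The forms [inl i] are the rows of [a] without column [d], with a nonzero default at [d]; the
   forms [inr i] are the coordinates. *)
pose l (k : G + G) j : R :=
  match k with
  | inl i => if i == d then 1 else a i j *+ (j != d)
  | inr i => (i == j)%:R
  end.
have [[i|i]|c c_gen] := exists_generic_vector (l := l).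
- have [->|id] := eqVneq i d; first by exists d; rewrite /= eqxx oner_neq0.
  have [j jd ij] := nbr i id; exists j; rewrite /= (negPf id) jd ae //.
  by apply: contraTneq ij => ->; rewrite edge_irr.
- by exists i; rewrite /= eqxx oner_neq0.
have c_neq0 i : c i != 0.
  have := c_gen (inr i); rewrite (bigD1 i) //= eqxx mul1r big1 ?addr0 // => j.
  by rewrite eq_sym => /negPf->; rewrite mul0r.
pose y i := \sum_(j | j != d) a i j * c j.
have y_neq0 i : i != d -> y i != 0.
  move=> id; have := c_gen (inl i); rewrite /= (negPf id); congr (_ != 0).
  rewrite /y [RHS]big_mkcond; apply: eq_bigr => j _.
  by case: eqP => _ /=; rewrite ?mulr1n ?mulr0n ?mul0r.
(* With $A_0$ the block of [a] away from [d] and $y = A_0 c$, the new row and column are $-y$ with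
   corner $c^T A_0 c$, so that $(1, c)$ is in the kernel. *)
pose a' i j :=
  if i == d then if j == d then \sum_(k | k != d) y k * c k else - y j
  else if j == d then - y i else a i j.
exists a', b, (fun i => if i == d then 1 else c i); split=> [|i|i]; last 2 first.
- by case: (i == d); rewrite ?oner_neq0 ?c_neq0.
- rewrite (bigD1 d) //= eqxx mulr1 {1}/a' eqxx.
  case: (eqVneq i d) => [->|id].
    rewrite -big_split big1 //= => j jd.
    by rewrite /a' eqxx (negPf jd) mulNr subrr.
  rewrite addrC; apply/eqP; rewrite subr_eq0; apply/eqP; apply: eq_bigr => j jd.
  by rewrite /a' (negPf id) (negPf jd).
split=> // [i j|i j ij|i z].
- by rewrite /a'; do 2!case: eqP.
- rewrite /a'; case: (eqVneq i d) ij => [->|id] ij.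
    by rewrite [j == d]eq_sym (negPf ij) oppr_eq0 y_neq0 ?dP // eq_sym.
  case: (eqVneq j d) ij => [->|jd] ij; last exact: ae.
  by rewrite oppr_eq0 y_neq0 // edge_sym dP.
(* Row [d] of [b] is zero, so column [d] of [a'] drops out; away from [d], the new row is a
   combination of rows of [a]. *)
- rewrite (bigD1 d) //= bd mulr0 add0r /a'.
  have [id|id] := eqVneq i d.
    transitivity (- \sum_(k | k != d) y k * b k z).
      by rewrite -sumrN; apply: eq_bigr => k /negPf->; rewrite mulNr.
    apply/eqP; rewrite oppr_eq0; apply/eqP.
    under eq_bigr do rewrite mulr_suml.
    rewrite exchange_big big1 //= => j _.
    transitivity (c j * \sum_k a j k * b k z); last by rewrite ab mulr0.
    rewrite mulr_sumr [RHS](bigD1 d) //= bd !mulr0 add0r.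
    by apply: eq_bigr => k _; rewrite as_ mulrA [c j * _]mulrC.
  rewrite -[RHS](ab i z) [RHS](bigD1 d) //= bd mulr0 add0r.
  by apply: eq_bigr => k /negPf->.
Qed.

(* A vertex outside of the component serves as the third vertex [w]. *)
Lemma notC_no_pendant_leaf (H G : sgraph) (f : H -> G) (w : G) :
  injective f -> {mono f : x y / edge x y} -> w \notin codom f ->
  (forall x y, y \notin codom f -> ~~ edge (f x) y) ->
  ~ classC G -> no_pendant_leaf H.
Proof.
move=> finj fe wf fout GC u v d uE vu; apply/negP => vd; case: GC; left.
have uv : ~~ edge u v.
  by rewrite uE; apply: contraTneq vd => ->; rewrite edge_irr.
have neqw x : f x != w by apply: contraNneq wf => <-; apply: codom_f.
(* The only neighbor [f d] of [f u] is also a neighbor of [f v], but not of [w]. *)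
apply/forbidden_tripleP; exists (f u), (f v), w, (f d); split.
- by rewrite /= !inE negb_or inj_eq // eq_sym vu !neqw.
- by rewrite fe.
- exact: fout.
- move=> y; case: (boolP (y \in codom f)) => [/codomP[x ->]|yf].
    by rewrite fe uE inj_eq // [edge w _]edge_sym fout ?andbT.
  rewrite (negPf (fout _ _ yf)); apply/esym/negbTE.
  by apply: contraNneq yf => ->; apply: codom_f.
- move=> y; case: (boolP (y \in codom f)) => [/codomP[x ->]|yf].
    by rewrite !fe uE => /eqP->.
  by rewrite (negPf (fout _ _ yf)).
Qed.

(** * Gluing along unions and induction over [classR] *)

(** All cross pairs are edges of the complement, so the mixed block of [b] must be nowhere zero,
    while its columns must lie in the kernels of [a1] and [a2]. *)
Lemma union_nonvanishing_kernel (R : realType) (G H : sgraph) :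
  nonvanishing_kernel R G -> nonvanishing_kernel R H ->
  complementary_vanishing R (disjoint_union G H).
Proof.
move=> [a1 [b1 [x1 [[as1 bs1 ae1 be1 ab1] x1_neq0 ax1]]]].
move=> [a2 [b2 [x2 [[as2 bs2 ae2 be2 ab2] x2_neq0 ax2]]]].
apply/complementary_vanishingP.
exists (fun s t => match s, t with
  | inl i, inl j => a1 i j | inr i, inr j => a2 i j | _, _ => 0 end).
exists (fun s t => match s, t with
  | inl i, inl j => b1 i j | inr i, inr j => b2 i j
  | inl i, inr j | inr j, inl i => x1 i * x2 j end).
split.
- by move=> [i|i] [j|j].
- by move=> [i|i] [j|j].
- by move=> [i|i] [j|j] ij //; rewrite ?eqxx ?ae1 ?ae2.
- by move=> [i|i] [j|j] ij; rewrite ?mulf_neq0 ?be1 ?be2.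
- move=> [i|i] [k|k]; rewrite big_sumType /=.
  + by rewrite ab1 add0r big1 // => j _; rewrite mul0r.
  + rewrite [X in _ + X]big1 ?addr0 => [|j _]; last by rewrite mul0r.
    by under eq_bigr do rewrite mulrA; rewrite -mulr_suml ax1 mul0r.
  + rewrite big1 ?add0r => [|j _]; last by rewrite mul0r.
    by under eq_bigr do rewrite mulrCA; rewrite -mulr_sumr ax2 mulr0.
  + by rewrite ab2 addr0 big1 // => j _; rewrite mul0r.
Qed.

Lemma complementary_vanishing_union (R : realType) (G H : sgraph) :
  ~ classC (disjoint_union G H) ->
  complementary_vanishing R G -> complementary_vanishing R H ->
  complementary_vanishing R (disjoint_union G H).
Proof.
move=> GHC GV HV.
have notl (h : H) : inr h \notin codom (@inl G H) by apply/codomP => -[].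
have notr (g : G) : inl g \notin codom (@inr G H) by apply/codomP => -[].
(* An empty summand is treated apart, since it offers no vertex outside of the other summand. *)
have [G0|/card_gt0P[g _]] := posnP #|G|.
  apply: complementary_vanishing_iso HV; exists inr => //.
  by apply: inj_card_bij => [x y []|] //; rewrite card_sum G0.
have [H0|/card_gt0P[h _]] := posnP #|H|.
  apply: complementary_vanishing_iso GV; exists inl => //.
  by apply: inj_card_bij => [x y []|] //; rewrite card_sum H0 addn0.
apply: union_nonvanishing_kernel; apply: vanishing_nonvanishing_kernel => //.
  apply: (@notC_no_pendant_leaf _ (disjoint_union G H) inl (inr h)) => //.
    by move=> x y [].
  by move=> x [y|//]; rewrite codom_f.
apply: (@notC_no_pendant_leaf _ (disjoint_union G H) inr (inl g)) => //.
  by move=> x y [].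
by move=> x [//|y]; rewrite codom_f.
Qed.

(** Induction on the derivation: both summands of a union are modules, so they stay outside of
    [classC]. *)
Lemma classR_complementary_vanishing (R : realType) (G : sgraph) :
  classR R G -> ~ classC G -> complementary_vanishing R G.
Proof.
have union_case (H K : sgraph) : ~ classC (disjoint_union H K) ->
    (~ classC H -> complementary_vanishing R H) ->
    (~ classC K -> complementary_vanishing R K) ->
    complementary_vanishing R (disjoint_union H K).
  move=> HKC HV KV; apply: complementary_vanishing_union => //.
    by apply: HV => HC; apply: HKC (classC_embedding (inl_embedding H K) HC).
  by apply: KV => KC; apply: HKC (classC_embedding (inr_embedding H K) KC).
have compl_case (H : sgraph) : (~ classC H -> complementary_vanishing R H) ->
    ~ classC (compl H) -> complementary_vanishing R (compl H).
  move=> HV HC; apply/complementary_vanishing_compl/HV => CH; apply: HC.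
  by apply/classC_compl; apply: classC_iso CH; apply/graph_iso_sym/complK.
have iso_case (H K : sgraph) : graph_iso H K ->
    (~ classC H -> complementary_vanishing R H) ->
    ~ classC K -> complementary_vanishing R K.
  move=> HK HV KC; apply: (complementary_vanishing_iso HK).
  by apply: HV => HC; apply: KC (classC_iso HK HC).
elim=> {G} [G []//|G H _ GV _ HV GHC|G H _ GV _ HV|G _|G H GH _].
- exact: union_case.
- have GCV := compl_case _ GV; have HCV := compl_case _ HV.
  apply: iso_case (compl_join G H) _; apply: compl_case => GHC.
  exact: union_case GHC GCV HCV.
- exact: compl_case.
- exact: iso_case.
Qed.

Theorem theorem1p5 (R : realType) (G : sgraph) :
  complementary_vanishing R G <-> (classR R G /\ ~ classC G).
Proof.
split=> [GV|[GR GC]]; last exact: classR_complementary_vanishing.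
split; first exact: complementary_vanishing_classR.
exact: complementary_vanishing_notC GV.
Qed.
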